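(* Let $k\ge 1$ be an integer, $N=2^k$, let $b$ be a natural number, and let $V=\mathrm{dfp}(b,N)$ be the output of the Direct Fourier Permutation Algorithm. Let $W=[0,1,2,\dots,2^k-1]$. Then $$V=b+R,$$ where $R=\mathrm{dfp}(0,N)$ is the bit-reversal permutation of $W$, i.e. the permutation of $W$ corresponding to the reversed $k$-bit representations of the components of $W$: for every $i\in\{1,\dots,2^k\}$, $R(i)=\mathrm{rev}_k(W(i))$ (equivalently, the list of the numbers $\mathrm{rev}_k(R(1)),\dots,\mathrm{rev}_k(R(2^k))$ is sorted in ascending order). The arithmetical complexity of the computation of $V$ by the algorithm is $O(N+k-1)$.
   Context: Vectors are finite sequences indexed from $1$. For a vector $V$ and a number $c$, $V+c=c+V$ denotes the vector obtained by adding $c$ to every component of $V$; $[V,U]$ denotes concatenation of vectors. For an integer $n$ with $0\le n\le 2^k-1$ and $k$-bit binary representation $n=\sum_{j=0}^{k-1} n_j2^j$, $n_j\in\{0,1\}$, the number obtained by reversing the $k$-bit representation is $\mathrm{rev}_k(n)=\sum_{j=0}^{k-1} n_j2^{k-1-j}$. The Direct Fourier Permutation Algorithm $\mathrm{dfp}(b,N)$, for a natural number $b$ and $N=2^k$ with $k>0$, is: 1. Initialize $V:=[b]$ (a vector of length 1) and $p_2:=N/2$. 2. While $p_2\ge 1$: replace $V$ by $[V,\,V+p_2]$, then replace $p_2$ by $p_2/2$. 3. Return $V$. The arithmetical complexity is the number of scalar arithmetic operations performed: a vectorial addition $V+p_2$ counts as as many scalar additions as $V$ has components, and each update $p_2:=p_2/2$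 counts as one division. *)

(* Defs.v *)
From mathcomp Require Import all_boot.

Set Implicit Arguments.
Unset Strict Implicit.
Unset Printing Implicit Defensive.

(* Components are numbered from 1: meaningful for 1 <= i <= size V. *)
Definition component (V : seq nat) (i : nat) : nat := nth 0 V i.-1.

Definition shift (c : nat) (V : seq nat) : seq nat := [seq c + x | x <- V].

Definition bit (n j : nat) : nat := (n %/ 2 ^ j) %% 2.

Definition rev_bits (k n : nat) : nat := \sum_(j < k) bit n j * 2 ^ (k - 1 - j).

(* The while loop of the algorithm, started in state (V, p2), with a running
   count [ops] of scalar operations: an iteration costs [size V] additions and
   one division.  [fuel] bounds the number of iterations; see [dfp_loopE].
   When N is a power of 2, every halving of p2 is exact except the one of
   p2 = 1, whose exact (1/2) and truncated (0) results both end the loop. *)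
Fixpoint dfp_while (fuel : nat) (V : seq nat) (p2 ops : nat) : seq nat * nat :=
  if fuel is fuel'.+1 then
    if 1 <= p2 then
      dfp_while fuel' (V ++ shift p2 V) (p2 %/ 2) (ops + (size V + 1))
    else (V, ops)
  else (V, ops).

(* Since p2 %/ 2 < p2 for p2 >= 1, p2 iterations are always enough. *)
Definition dfp_loop (V : seq nat) (p2 ops : nat) : seq nat * nat :=
  dfp_while p2 V p2 ops.

Lemma dfp_while_fuel fuel V p2 ops :
  p2 <= fuel -> dfp_while fuel V p2 ops = dfp_loop V p2 ops.
Proof.
rewrite /dfp_loop; elim/ltn_ind: p2 fuel V ops => p2 IH fuel V ops.
case: p2 IH => [|p] IH; first by case: fuel.
case: fuel => // fuel le_pf /=.
have lt_hp : p.+1 %/ 2 < p.+1 by rewrite ltn_Pdiv.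
rewrite IH ?(leq_trans _ le_pf) //; last by rewrite -ltnS (leq_trans lt_hp).
by rewrite [RHS]IH.
Qed.

(* The fuel never runs out: [dfp_loop] obeys the equation of the while loop. *)
Lemma dfp_loopE V p2 ops :
  dfp_loop V p2 ops =
  if 1 <= p2 then dfp_loop (V ++ shift p2 V) (p2 %/ 2) (ops + (size V + 1))
  else (V, ops).
Proof.
case: p2 => [|p] //; rewrite {1}/dfp_loop /= dfp_while_fuel //.
by rewrite -ltnS ltn_Pdiv.
Qed.

(* The count starts at 1, for the division in the initialization p2 := N/2. *)
Definition dfp_run (b N : nat) : seq nat * nat := dfp_loop [:: b] (N %/ 2) 1.

Definition dfp (b N : nat) : seq nat := (dfp_run b N).1.

Definition dfp_complexity (b N : nat) : nat := (dfp_run b N).2.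

(* Main.v *)
Require Import Defs.
From mathcomp Require Import all_boot zify.

Set Implicit Arguments.
Unset Strict Implicit.
Unset Printing Implicit Defensive.

(** The loop body is the doubling identity of bit reversal.  If [x < 2 ^ j]
    and [j < k], adding [2 ^ j] to [x] sets its bit [j], which was clear, and
    reversal sends that bit to position [k - 1 - j]; hence
    [rev_bits k (2 ^ j + x) = 2 ^ (k - 1 - j) + rev_bits k x]
    ([rev_bits_setbit]).  So if [V] lists [b + rev_bits k x] for [x < 2 ^ j]
    in increasing order of [x], and [p2 = 2 ^ (k - 1 - j)], then
    [V ++ shift p2 V] is the same list for [x < 2 ^ j.+1].  This is the loop
    invariant behind [dfp_runE]: after [k] iterations, the vector is
    [b + rev_bits k x] for [x < 2 ^ k].

    The claims about [R] follow because [rev_bits k] is an involution of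
    [0, 2 ^ k): applying it to the components of [R] gives [W] back, and a
    permutation of [W] whose reversals are sorted must reverse to [W] itself,
    the only sorted arrangement of [W], hence be [R].

    Iteration [j] costs [2 ^ j + 1] operations, so together with the initial
    division the run costs exactly [1 + (2 ^ k - 1) + k = 2 ^ k + k], which is
    at most twice [2 ^ k + k - 1]. *)

Lemma bit0 n : bit n 0 = n %% 2.
Proof. by rewrite /bit expn0 divn1. Qed.

Lemma bitS n j : bit n j.+1 = bit (n %/ 2) j.
Proof. by rewrite /bit expnS divnMA. Qed.

Lemma bit_lt2 n j : bit n j < 2.
Proof. by rewrite ltn_mod. Qed.

Lemma binary_sum_recl k (a : nat -> nat) :
  \sum_(i < k.+1) a i * 2 ^ i = (\sum_(i < k) a i.+1 * 2 ^ i) * 2 + a 0.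
Proof.
rewrite big_ord_recl muln1 addnC big_distrl /=; congr (_ + _).
by apply: eq_bigr => i _; rewrite /bump add1n expnSr mulnA.
Qed.

Lemma binary_sum_lt k (a : nat -> nat) :
  (forall i, a i < 2) -> \sum_(i < k) a i * 2 ^ i < 2 ^ k.
Proof.
elim: k a => [|k IH] a a_lt2; first by rewrite big_ord0.
rewrite binary_sum_recl expnS.
have := IH (fun i => a i.+1) (fun i => a_lt2 i.+1); have := a_lt2 0; lia.
Qed.

Lemma bit_binary_sum k (a : nat -> nat) j :
  (forall i, a i < 2) -> j < k -> bit (\sum_(i < k) a i * 2 ^ i) j = a j.
Proof.
elim: k a j => [|k IH] a [|j] a_lt2 // lt_jk; rewrite binary_sum_recl.
  by rewrite bit0 modnMDl modn_small.
by rewrite bitS divnMDl // divn_small // addn0 (IH (fun i => a i.+1)).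
Qed.

Lemma binary_sum_bit k n : n < 2 ^ k -> \sum_(i < k) bit n i * 2 ^ i = n.
Proof.
elim: k n => [|k IH] n; first by rewrite big_ord0; case: n.
rewrite expnS => lt_n; rewrite binary_sum_recl bit0.
under eq_bigr => i _ do rewrite bitS.
by rewrite IH -?divn_eq // ltn_divLR // mulnC.
Qed.

Lemma rev_bitsE k n : rev_bits k n = \sum_(i < k) bit n (k - 1 - i) * 2 ^ i.
Proof.
rewrite /rev_bits (reindex_inj rev_ord_inj) /=; apply: eq_bigr => i _.
by congr (bit n _ * 2 ^ _); have := ltn_ord i; lia.
Qed.

Lemma rev_bits_lt k n : rev_bits k n < 2 ^ k.
Proof.
rewrite rev_bitsE; apply: (@binary_sum_lt k (fun i => bit n (k - 1 - i))) => i.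
exact: bit_lt2.
Qed.

Lemma bit_rev_bits k n j : j < k -> bit (rev_bits k n) j = bit n (k - 1 - j).
Proof.
move=> lt_jk; rewrite rev_bitsE.
rewrite (@bit_binary_sum k (fun i => bit n (k - 1 - i))) // => i.
exact: bit_lt2.
Qed.

Lemma rev_bitsK k n : n < 2 ^ k -> rev_bits k (rev_bits k n) = n.
Proof.
move=> lt_n; rewrite rev_bitsE -[RHS](binary_sum_bit lt_n).
apply: eq_bigr => i _; have lt_ik := ltn_ord i.
by rewrite bit_rev_bits; [congr (bit n _ * _)|]; lia.
Qed.

(** Adding [2 ^ j] causes no carry, since bit [j] of [x] and all higher ones
    are clear. *)
Lemma bit_setbit j x i : x < 2 ^ j -> bit (2 ^ j + x) i = (i == j) + bit x i.
Proof.
elim: j x i => [|j IH] x [|i].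
- by rewrite ltnS leqn0 => /eqP ->.
- by rewrite ltnS leqn0 => /eqP ->; rewrite bitS divn_small // /bit !div0n.
- by rewrite !bit0 expnS mulnC modnMDl.
rewrite expnS => lt_x.
by rewrite !bitS mulnC divnMDl // IH // ltn_divLR // mulnC.
Qed.

Lemma rev_bits_setbit k j x : j < k -> x < 2 ^ j ->
  rev_bits k (2 ^ j + x) = 2 ^ (k - 1 - j) + rev_bits k x.
Proof.
move=> lt_jk lt_x; rewrite /rev_bits.
under eq_bigr => i _ do rewrite bit_setbit // mulnDl.
rewrite big_split /=; congr (_ + _).
rewrite (bigD1 (Ordinal lt_jk)) //= eqxx mul1n big1 ?addn0 // => i.
by rewrite -val_eqE => /negbTE ->.
Qed.

Lemma rev_bits0 k : rev_bits k 0 = 0.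
Proof. by apply: big1 => i _; rewrite /bit div0n. Qed.

Definition rev_table (k b j : nat) : seq nat :=
  [seq b + rev_bits k x | x <- iota 0 (2 ^ j)].

Lemma size_rev_table k b j : size (rev_table k b j) = 2 ^ j.
Proof. by rewrite size_map size_iota. Qed.

Lemma rev_table_double k b j : j < k ->
  rev_table k b j ++ shift (2 ^ (k - 1 - j)) (rev_table k b j) =
  rev_table k b j.+1.
Proof.
move=> lt_jk; rewrite /rev_table /shift expnS mul2n -addnn iotaD map_cat.
congr (_ ++ _); rewrite -[0 + 2 ^ j]addnC iotaDl -!map_comp.
apply/eq_in_map => x; rewrite mem_iota => lt_x /=.
by rewrite rev_bits_setbit // addnCA.
Qed.

(** The loop invariant, at a state from which [m] iterations remain.  Writing
    [p2] as [2 ^ m %/ 2] also covers the exit state [m = 0], where the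
    truncated half of [1] is [0].  The difference [2 ^ (j + m) - 2 ^ j] is the
    geometric sum of the lengths [2 ^ j], ..., [2 ^ (j + m - 1)] of the vectors
    added to. *)
Lemma dfp_loop_rev_table b m j ops :
  dfp_loop (rev_table (j + m) b j) (2 ^ m %/ 2) ops =
  (rev_table (j + m) b (j + m), ops + m + (2 ^ (j + m) - 2 ^ j)).
Proof.
elim: m j ops => [|m IH] j ops.
  by rewrite dfp_loopE /= !addn0 subnn addn0.
rewrite dfp_loopE expnS mulKn // expn_gt0 /=.
have lt_jk : j < j + m.+1 by lia.
have p2E : j + m.+1 - 1 - j = m by lia.
have := rev_table_double b lt_jk; rewrite p2E => ->.
rewrite -addSnnS IH size_rev_table; congr (_, _).
have : 2 ^ j.+1 <= 2 ^ (j.+1 + m) by rewrite leq_exp2l // leq_addr.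
rewrite [2 ^ j.+1]expnS; lia.
Qed.

Lemma dfp_runE k b : dfp_run b (2 ^ k) = (rev_table k b k, 2 ^ k + k).
Proof.
have tab0 : rev_table k b 0 = [:: b] by rewrite /rev_table /= rev_bits0 addn0.
rewrite /dfp_run -tab0 (dfp_loop_rev_table b k 0); congr (_, _).
have : 0 < 2 ^ k by rewrite expn_gt0.
by rewrite add0n expn0; lia.
Qed.

Lemma dfpE k b : dfp b (2 ^ k) = rev_table k b k.
Proof. by rewrite /dfp dfp_runE. Qed.

Lemma map_rev_bitsK k (s : seq nat) : {in s, forall x, x < 2 ^ k} ->
  [seq rev_bits k x | x <- [seq rev_bits k x | x <- s]] = s.
Proof.
move=> s_lt; rewrite -map_comp -[RHS]map_id; apply/eq_in_map => x /s_lt.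
exact: rev_bitsK.
Qed.

Lemma perm_map_rev_bits k :
  perm_eq [seq rev_bits k x | x <- iota 0 (2 ^ k)] (iota 0 (2 ^ k)).
Proof.
have lt_iota : {in iota 0 (2 ^ k), forall x, x < 2 ^ k}.
  by move=> x; rewrite mem_iota.
apply: uniq_perm; rewrite ?iota_uniq //.
  apply: (@map_uniq _ _ (rev_bits k)).
  by rewrite map_rev_bitsK // iota_uniq.
move=> x; rewrite mem_iota add0n /=.
apply/mapP/idP => [[y _ ->]|lt_x]; first exact: rev_bits_lt.
exists (rev_bits k x); last by rewrite rev_bitsK.
by rewrite mem_iota rev_bits_lt.
Qed.

(** Sorting is unique: a permutation of [0, 2 ^ k) reverses to a sorted list
    only if it reverses to [iota 0 (2 ^ k)], and reversal can be undone. *)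
Lemma sorted_map_rev_bits k (s : seq nat) : perm_eq s (iota 0 (2 ^ k)) ->
  sorted leq [seq rev_bits k x | x <- s] <->
  s = [seq rev_bits k x | x <- iota 0 (2 ^ k)].
Proof.
move=> perm_s.
have lt_s : {in s, forall x, x < 2 ^ k}.
  by move=> x; rewrite (perm_mem perm_s) mem_iota.
split=> [sorted_s | ->]; last first.
  by rewrite map_rev_bitsK ?iota_sorted // => x; rewrite mem_iota.
rewrite -[LHS](map_rev_bitsK lt_s); congr map.
apply: (sorted_eq leq_trans anti_leq) => //; first exact: iota_sorted.
exact: perm_trans (perm_map (rev_bits k) perm_s) (perm_map_rev_bits k).
Qed.

Lemma component_iota_mapP (f : nat -> nat) n (s : seq nat) : size s = n ->
  (forall i, 1 <= i <= n -> component s i = f (component (iota 0 n) i)) <->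
  s = [seq f x | x <- iota 0 n].
Proof.
move=> size_s; split=> [eq_s | -> i /andP[i_gt0 le_in]].
  apply: (@eq_from_nth _ 0) => [|i]; first by rewrite size_map size_iota.
  rewrite size_s => lt_in; rewrite (nth_map 0) ?size_iota //.
  exact: (eq_s i.+1).
by rewrite /component (nth_map 0) // size_iota prednK.
Qed.

Theorem theorem1 :
  (forall k b : nat, 1 <= k ->
     let N := 2 ^ k in
     let V := dfp b N in
     let W := iota 0 N in
     let R := dfp 0 N in
     [/\ V = shift b R,
         perm_eq R W,
         forall i : nat, 1 <= i <= N ->
           component R i = rev_bits k (component W i),
         sorted leq [seq rev_bits k x | x <- R]
       & forall S : seq nat, perm_eq S W ->
           ((forall i : nat, 1 <= i <= N ->
               component S i = rev_bits k (component W i)) <->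
            sorted leq [seq rev_bits k x | x <- S])]) /\
  (exists C : nat, forall k b : nat, 1 <= k ->
     dfp_complexity b (2 ^ k) <= C * (2 ^ k + k - 1)).
Proof.
split=> [k b _ N V W R|]; last first.
  exists 2 => k b k_gt0; rewrite /dfp_complexity dfp_runE /=.
  have : 0 < 2 ^ k by rewrite expn_gt0.
  lia.
have R_E : R = [seq rev_bits k x | x <- W] by rewrite /R dfpE.
have perm_R : perm_eq R W by rewrite R_E perm_map_rev_bits.
have size_perm S : perm_eq S W -> size S = N.
  by move=> /perm_size ->; rewrite size_iota.
split=> //.
- by rewrite R_E /V dfpE /shift -map_comp.
- by apply/component_iota_mapP; first exact: size_perm.
- exact/sorted_map_rev_bits.
move=> S perm_S.
apply: iff_trans (iff_sym (sorted_map_rev_bits perm_S)).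
exact/component_iota_mapP/size_perm.
Qed.
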